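(* Let $\varphi\in\mathscr{A}(D_\Delta)$. Then, for all $\lambda\in[0,1]\cap\mathbb{Q}$ and $u\in D_\Delta$, $$\mathscr{E}[\varphi](\lambda,u)\leq\sum_{k=0}^\infty\frac{1}{2^k}\varphi^*\big(d_{\mathbb{Z}}(2^k\lambda)u\big);$$ furthermore, the series on the right-hand side is absolutely convergent, and if $\lambda=\frac{n}{n+m}$ for some $n,m\in\mathbb{N}$, then, for all $u\in D_\Delta$, $$\sum_{k=0}^\infty\frac{1}{2^k}\varphi^*\big(d_{\mathbb{Z}}(2^k\lambda)u\big)\leq nm\,\varphi^*\Big(\frac{u}{n+m}\Big).$$
   Context: $\mathbb{N}=\{1,2,3,\dots\}$. $X$ is a real linear space and $D\subseteq X$ is a nonempty convex set; $D_\Delta:=\{x-y : x,y\in D\}$. Given $\varphi:\frac12D_\Delta\to\mathbb{R}$, a function $f:D\to\mathbb{R}$ is called $\varphi$-Jensen convex if $f\big(\frac{x+y}{2}\big)\leq\frac12f(x)+\frac12f(y)+\varphi\big(\frac{x-y}{2}\big)$ for all $x,y\in D$. $\mathscr{A}(D_\Delta)$ denotes the family of all admissible error functions, i.e. of all even functions $\varphi:\frac12D_\Delta\to\mathbb{R}$ with $\varphi(0)=0$ for which there exists at least one $\varphi$-Jensen convex function $f:D\to\mathbb{R}$. For $\varphi:\frac12D_\Delta\to\mathbb{R}$, define $\varphi^*:\frac12D_\Delta\to[-\infty,\infty)$ by $\varphi^*(u):=\inf_{m\in\mathbb{N}}m^2\varphi\big(\frac{u}{m}\big)$ (for $\varphi\in\mathscr{A}(D_\Delta)$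 the function $\varphi^*$ is real-valued). For $\varphi\in\mathscr{A}(D_\Delta)$, define $\mathscr{E}[\varphi]:[0,1]\times D_\Delta\to(-\infty,\infty]$ by $$\mathscr{E}[\varphi](\lambda,u):=\sup\big\{f(\lambda x+(1-\lambda)y)-\lambda f(x)-(1-\lambda)f(y) \;\big|\; f:D\to\mathbb{R}\text{ is }\varphi\text{-Jensen convex},\ x,y\in D,\ x-y=u\big\}.$$ For $x\in\mathbb{R}$, $d_{\mathbb{Z}}(x):=\inf\{|x-k| : k\in\mathbb{Z}\}$. *)

(* Defs.v *)
From HB Require Import structures.
From mathcomp Require Import all_boot all_order all_algebra.
From mathcomp Require Import all_classical all_reals all_analysis.

Set Implicit Arguments.
Unset Strict Implicit.
Unset Printing Implicit Defensive.

Import Order.TTheory GRing.Theory Num.Theory.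

Local Open Scope classical_set_scope.
Local Open Scope ring_scope.

(* Functions on D and on (1/2) D_Delta are total functions on X of which only
   the values on D, resp. (1/2) D_Delta, are ever constrained or used: the
   convex symmetric set (1/2) D_Delta is stable under u |-> u / m. *)

Section JensenConvexity.
Variables (R : realType) (X : lmodType R).
Implicit Types (D : set X) (phi f : X -> R) (u : X) (lambda : R).

Definition diff_set D : set X := [set x - y | x in D & y in D].

Definition half_diff_set D : set X := [set 2^-1 *: u | u in diff_set D].

Definition jensen_convex D phi f : Prop :=
  forall x y, D x -> D y ->
    f (2^-1 *: (x + y)) <= 2^-1 * f x + 2^-1 * f y + phi (2^-1 *: (x - y)).

Definition admissible D phi : Prop :=
  [/\ forall u, half_diff_set D u -> phi (- u) = phi u,
      phi 0 = 0 &
      exists f, jensen_convex D phi f].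

Definition phi_star phi u : \bar R :=
  ereal_inf [set (m%:R ^+ 2 * phi (m%:R^-1 *: u))%:E | m in [set m | (0 < m)%N]].

Definition convexity_error D phi lambda u : \bar R :=
  ereal_sup [set z | exists f x y,
    [/\ jensen_convex D phi f, D x, D y, x - y = u &
        z = (f (lambda *: x + (1 - lambda) *: y)
             - lambda * f x - (1 - lambda) * f y)%:E]].

Definition dist_int (x : R) : R := inf [set `|x - k%:~R| | k in [set: int]].

Definition takagi_term phi lambda u (k : nat) : \bar R :=
  ((2 ^+ k)^-1%:E * phi_star phi (dist_int (2 ^+ k * lambda) *: u))%E.

End JensenConvexity.

(* Main.v *)
Require Import Defs.
From HB Require Import structures.
From mathcomp Require Import all_boot all_order all_algebra.
From mathcomp Require Import all_classical all_reals all_analysis.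
From mathcomp Require Import ring lra.

Set Implicit Arguments.
Unset Strict Implicit.
Unset Printing Implicit Defensive.

Import Order.TTheory GRing.Theory Num.Theory.
Import numFieldNormedType.Exports.

Local Open Scope classical_set_scope.
Local Open Scope ring_scope.

(** Restrict a phi-Jensen convex f to the segment t |-> t x + (1 - t) y, with
    x - y = u: the statement becomes one about functions of t in [0, 1] and
    about the ray t |-> phi (t u).

    Subdividing a segment shows that f is even phi^*-Jensen convex: on the
    points c + i h, |i| <= m, the second differences of f are at least
    -2 phi (h u), hence the midpoint defect over the whole segment is at most
    m^2 phi (h u) ([midpoint_defect_refine], [jensen_segment_star]).  In
    particular phi^* is finite on the rays that occur ([phi_star_fin]).

    Let T be the doubling map of [0, 1] and tent t = min (t, 1 - t).  Every t is
    the midpoint of T t and of an endpoint, at half-distance tent t, so the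
    convexity error e of f at t satisfies

      e t <= phi^* (tent t u) + e (T t) / 2.

    Since tent (T^k t) is the distance from 2^k t to the integers, iterating K
    times yields the K-th partial sum of the Takagi-type series, plus the
    remainder e (T^K t) / 2^K.  For t in the finite set {0, 1/N, ..., N/N},
    which T preserves, every function of T^K t is bounded in K; so the remainder
    vanishes in the limit, and the series converges absolutely because its
    coefficients are bounded.

    For the last inequality write t = n / N with N = n + m.  Then N tent (T^k t)
    is a natural number j, and phi^* (j v) <= j^2 phi^* v, because the infimum
    defining phi^* (j v) includes the indices multiple of j.  With v = u / N,
    the series is thus at most N^2 phi^* v times the sum of the
    tent (T^k t)^2 / 2^k.  That sum is t (1 - t), by iterating

      t (1 - t) = (tent t)^2 + T t (1 - T t) / 2.

    An identity, rather than a bound, is needed here as phi^* v may be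
    negative. *)

(** * Discrete convexity and subdivision *)

(** A discrete Taylor estimate: the i-th first difference accumulates i second
    differences, each at least -4p, on top of the initial one, -2p.  The latter
    is half as large because G stands for a symmetrised function
    g (c + i h) + g (c - i h) - 2 g c, whose second difference at 0 is twice its
    first difference. *)
Lemma second_difference_bound (R : realType) (m : nat) (p : R) (G : nat -> R) :
  G 0%N = 0 -> ((0 < m)%N -> - (2 * p) <= G 1%N) ->
  (forall i, (i.+1 < m)%N -> - (4 * p) <= G i.+2 - 2 * G i.+1 + G i) ->
  - (2 * m%:R ^+ 2 * p) <= G m.
Proof.
move=> G0 G1 GS.
have dG i : (i < m)%N -> - ((4 * i%:R + 2) * p) <= G i.+1 - G i.
  elim: i => [|i IH] im; first by have := G1 im; rewrite G0; lra.
  have := IH (ltnW im); have := GS i im; rewrite -[i.+1%:R]natr1; lra.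
suff H i : (i <= m)%N -> - (2 * i%:R ^+ 2 * p) <= G i by exact: H.
elim: i => [|i IH] im; first by rewrite G0; lra.
have := IH (ltnW im); have := dG i im; rewrite -[i.+1%:R]natr1; lra.
Qed.

(** Splitting the segment from t to s into 2m pieces replaces the error
    psi ((s - t) / 2) by m^2 psi ((s - t) / 2m): around the midpoint, g has second
    differences at least -2 psi ((s - t) / 2m). *)
Lemma midpoint_defect_refine (R : realType) (g psi : R -> R) (m : nat) (s t : R) :
  (forall a b, 0 <= a <= 1 -> 0 <= b <= 1 ->
     g ((a + b) / 2) <= g a / 2 + g b / 2 + psi ((a - b) / 2)) ->
  (0 < m)%N -> 0 <= s <= 1 -> 0 <= t <= 1 ->
  g ((s + t) / 2) <= g s / 2 + g t / 2 + m%:R ^+ 2 * psi ((s - t) / 2 / m%:R).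
Proof.
move=> gJ m0 s01 t01.
have m0R : 0 < m%:R :> R by rewrite ltr0n.
pose c := (s + t) / 2; pose h := (s - t) / 2 / m%:R.
have hm : m%:R * h = (s - t) / 2 by rewrite /h mulrC divfK// gt_eqF.
have in01 i : (i <= m)%N -> 0 <= c + i%:R * h <= 1 /\ 0 <= c - i%:R * h <= 1.
  move=> im; have [i0 im'] : 0 <= i%:R :> R /\ i%:R <= m%:R :> R.
    by rewrite ler0n ler_nat.
  have bnd : `|i%:R * h| <= `|(s - t) / 2|.
    by rewrite -hm !normrM ler_wpM2r// !ger0_norm// ltW.
  have : - `|(s - t) / 2| <= i%:R * h <= `|(s - t) / 2| by rewrite -ler_norml.
  rewrite /c; case: (ger0P ((s - t) / 2)) => _; lra.
pose G i := g (c + i%:R * h) + g (c - i%:R * h) - 2 * g c.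
have := @second_difference_bound R m (psi h) G.
have -> : G m = g s + g t - 2 * g c.
  by rewrite /G hm /c; congr (g _ + g _ - _); field.
have G0 : G 0%N = 0 by rewrite /G mul0r addr0 subr0; ring.
have G1 : (0 < m)%N -> - (2 * psi h) <= G 1%N.
  move=> m1; have [a b] := in01 1%N m1.
  have := gJ _ _ a b.
  have -> : (c + 1%:R * h + (c - 1%:R * h)) / 2 = c by field.
  have -> : (c + 1%:R * h - (c - 1%:R * h)) / 2 = h by field.
  by rewrite /G; lra.
have GS i : (i.+1 < m)%N -> - (4 * psi h) <= G i.+2 - 2 * G i.+1 + G i.
  move=> im; have [a2 b2] := in01 _ im.
  have [a0 b0] := in01 i (ltnW (ltnW im)).
  have := gJ _ _ a2 a0; have := gJ _ _ b0 b2.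
  rewrite /G -[i.+2%:R]natr1 -[i.+1%:R]natr1.
  have -> : (c + (i%:R + 1 + 1) * h + (c + i%:R * h)) / 2 = c + (i%:R + 1) * h.
    by field.
  have -> : (c - i%:R * h + (c - (i%:R + 1 + 1) * h)) / 2 = c - (i%:R + 1) * h.
    by field.
  have -> : (c + (i%:R + 1 + 1) * h - (c + i%:R * h)) / 2 = h by field.
  have -> : (c - i%:R * h - (c - (i%:R + 1 + 1) * h)) / 2 = h by field.
  by move: (g _) (g _) (g _) (g _) (g _) (g _) (psi h) => *; lra.
by move=> /(_ G0 G1 GS); rewrite -/c -/h; lra.
Qed.

(** * Restriction to a segment *)

Section Segment.
Variables (R : realType) (X : lmodType R) (D : set X).
Hypothesis D_convex : convex_set D.
Variables (x y : X).
Hypotheses (Dx : D x) (Dy : D y).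

Definition segment (t : R) : X := t *: x + (1 - t) *: y.

Lemma segment0 : segment 0 = y.
Proof. by rewrite /segment scale0r subr0 scale1r add0r. Qed.

Lemma segment1 : segment 1 = x.
Proof. by rewrite /segment scale1r subrr scale0r addr0. Qed.

Lemma segment_sub a b : segment a - segment b = (a - b) *: (x - y).
Proof.
rewrite /segment opprD addrACA -!scalerBl [in RHS]scalerBr -[in RHS]scaleNr.
by congr (_ + _ *: _); ring.
Qed.

Lemma segment_mid a b : 2^-1 *: (segment a + segment b) = segment ((a + b) / 2).
Proof.
rewrite /segment addrACA -!scalerDl scalerDr !scalerA.
by congr (_ *: _ + _ *: _); field.
Qed.

Lemma segment_in (t : R) : 0 <= t <= 1 -> D (segment t).
Proof.
move=> /andP[t0 t1].
have := D_convex (Itv01 t0 t1) (mem_set Dx) (mem_set Dy).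
by rewrite inE.
Qed.

Lemma segment_jensen (phi f : X -> R) : jensen_convex D phi f ->
  forall a b : R, 0 <= a <= 1 -> 0 <= b <= 1 ->
  f (segment ((a + b) / 2)) <= f (segment a) / 2 + f (segment b) / 2
                           + phi (((a - b) / 2) *: (x - y)).
Proof.
move=> fJ a b a01 b01.
have := fJ _ _ (segment_in a01) (segment_in b01).
by rewrite segment_mid segment_sub scalerA ![2^-1 * _]mulrC.
Qed.

End Segment.

(** * The function phi^* *)

Section PhiStar.
Variables (R : realType) (X : lmodType R).
Implicit Types (phi : X -> R) (u : X).

Lemma phi_star_le phi u m : (0 < m)%N ->
  (phi_star phi u <= (m%:R ^+ 2 * phi (m%:R^-1 *: u))%:E)%E.
Proof. by move=> m0; apply: ereal_inf_lbound; exists m. Qed.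

Lemma phi_star_ge phi u (c : R) :
  (forall m, (0 < m)%N -> c <= m%:R ^+ 2 * phi (m%:R^-1 *: u)) ->
  (c%:E <= phi_star phi u)%E.
Proof.
by move=> H; apply: le_ereal_inf_tmp => _ [m m0 <-]; rewrite lee_fin; exact: H.
Qed.

Lemma phi_star_lt_pinfty phi u : (phi_star phi u < +oo)%E.
Proof. by apply: le_lt_trans (phi_star_le phi u (isT : (0 < 1)%N)) _; rewrite ltry. Qed.

Lemma phi_star0 phi : phi 0 = 0 -> phi_star phi 0 = 0%E.
Proof.
move=> phi0; apply/eqP; rewrite eq_le; apply/andP; split.
  by have := phi_star_le phi 0 (isT : (0 < 1)%N); rewrite scaler0 phi0 mulr0.
by apply: phi_star_ge => m _; rewrite scaler0 phi0 mulr0.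
Qed.

(** The competitors with index j m in the infimum defining phi^* (j u) are j^2
    times those with index m in the one defining phi^* u. *)
Lemma phi_star_natmul phi u j : (0 < j)%N ->
  (phi_star phi (j%:R *: u) <= (j%:R ^+ 2)%:E * phi_star phi u)%E.
Proof.
move=> j0; have j0R : 0 < j%:R ^+ 2 :> R by rewrite exprn_gt0// ltr0n.
rewrite -lee_pdivrMl// [leRHS]/phi_star; apply: le_ereal_inf_tmp => _ [m m0 <-].
rewrite lee_pdivrMl//.
apply: le_trans (phi_star_le (m := j * m) phi _ _) _; first by rewrite muln_gt0 j0.
have jm : (j * m)%:R^-1 * j%:R = m%:R^-1 :> R.
  by rewrite natrM invfM mulrAC mulVf ?mul1r// pnatr_eq0 -lt0n.
by rewrite -EFinM lee_fin scalerA jm natrM exprMn -mulrA.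
Qed.

End PhiStar.

(** * Jensen convexity with error phi^* *)

Section FixedDifference.
Variables (R : realType) (X : lmodType R) (D : set X).
Hypothesis D_convex : convex_set D.
Variables (phi f0 : X -> R).
Hypothesis f0J : jensen_convex D phi f0.
Hypothesis phi0 : phi 0 = 0.
Variable u : X.
Hypothesis Du : diff_set D u.

(** Any phi-Jensen convex function is phi^*-Jensen convex. The bound is stated as
    a lower bound on phi^* so that it also shows that phi^* is finite. *)
Lemma jensen_segment_star f x y (a b : R) : jensen_convex D phi f ->
  D x -> D y -> x - y = u -> 0 <= a <= 1 -> 0 <= b <= 1 ->
  ((f (segment x y ((a + b) / 2)) - f (segment x y a) / 2
     - f (segment x y b) / 2)%:E <= phi_star phi (((a - b) / 2) *: u))%E.
Proof.
move=> fJ Dx Dy xyu a01 b01; apply: phi_star_ge => m m0.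
have := @midpoint_defect_refine R (f \o segment x y) (fun t => phi (t *: u)) m a b.
rewrite -xyu => /(_ (segment_jensen D_convex Dx Dy fJ) m0 a01 b01) /=.
by rewrite scalerA [m%:R^-1 * _]mulrC; lra.
Qed.

(** The midpoint defect of any one phi-Jensen convex function bounds phi^* from
    below; t u is half the difference of the points of parameters 2t and 0. *)
Lemma phi_star_fin (t : R) : 0 <= t <= 1 / 2 ->
  phi_star phi (t *: u) \is a fin_num.
Proof.
move=> t01; have [x Dx [y Dy xyu]] := Du.
have a01 : 0 <= 2 * t <= 1 by lra.
have b01 : 0 <= (0 : R) <= 1 by lra.
have := jensen_segment_star f0J Dx Dy xyu a01 b01.
have -> : (2 * t - 0) / 2 = t by field.
move=> H; rewrite fin_real// phi_star_lt_pinfty andbT.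
by apply: lt_le_trans H; rewrite ltNyr.
Qed.

Definition star_ray (t : R) : R := fine (phi_star phi (t *: u)).

Lemma star_rayE t : 0 <= t <= 1 / 2 -> (star_ray t)%:E = phi_star phi (t *: u).
Proof. by move=> ht; rewrite fineK// phi_star_fin. Qed.

Lemma star_ray_natmul j t : 0 <= t -> j%:R * t <= 1 / 2 ->
  star_ray (j%:R * t) <= j%:R ^+ 2 * star_ray t.
Proof.
case: j => [|j] t0 jt; first by rewrite mul0r /star_ray scale0r phi_star0// expr0n/= mul0r.
have j1 : 1 <= j.+1%:R :> R by rewrite ler1n.
have jt0 : t <= j.+1%:R * t by rewrite ler_peMl.
rewrite -lee_fin EFinM !star_rayE; [|lra|lra].
by rewrite -scalerA; exact: phi_star_natmul.
Qed.

End FixedDifference.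

(** * The doubling map and the distance to the integers *)

Section Doubling.
Variable R : realType.
Implicit Types t : R.

Definition doubling t : R := if t <= 1 / 2 then 2 * t else 2 * t - 1.

Definition tent t : R := Num.min t (1 - t).

Lemma doubling_in01 t : 0 <= t <= 1 -> 0 <= doubling t <= 1.
Proof. by rewrite /doubling; case: ifPn => //; rewrite -?ltNge; lra. Qed.

Lemma iter_doubling_in01 k t : 0 <= t <= 1 -> 0 <= iter k doubling t <= 1.
Proof. by move=> t01; elim: k => //= k IH; exact: doubling_in01. Qed.

Lemma tent_in t : 0 <= t <= 1 -> 0 <= tent t <= 1 / 2.
Proof. by rewrite /tent; case: (leP t (1 - t)); lra. Qed.

Lemma dist_int_in01 t : 0 <= t <= 1 -> dist_int t = tent t.
Proof.
move=> t01; apply/eqP; rewrite eq_le; apply/andP; split; last first.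
  apply: lb_le_inf; first by exists `|t - 0%:~R|, 0.
  move=> _ [k _ <-]; rewrite /tent.
  have [k0|k1] := leP k 0.
    have : k%:~R <= 0 :> R by rewrite lerz0.
    by case: (leP t (1 - t)) => ? ?; rewrite ger0_norm; lra.
  have : 1 <= k%:~R :> R by rewrite ler1z -gtz0_ge1.
  by case: (leP t (1 - t)) => ? ?; rewrite ler0_norm; lra.
have lb : has_lbound [set `|t - k%:~R| | k in [set: int]].
  by exists 0 => _ [k _ <-].
rewrite /tent; case: (leP t (1 - t)) => ?; apply: ge_inf => //.
  by exists 0 => //; rewrite subr0 ger0_norm; lra.
by exists 1 => //; rewrite ler0_norm; lra.
Qed.

Lemma dist_int_addz t (z : int) : dist_int (t + z%:~R) = dist_int t.
Proof.
rewrite /dist_int; congr inf; apply/seteqP; split => _ [k _ <-].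
  by exists (k - z) => //; rewrite intrB; congr `|_|; ring.
by exists (k + z) => //; rewrite intrD; congr `|_|; ring.
Qed.

(** The distance to the integers is 1-periodic, and the k-th iterate of the
    doubling map is 2^k t up to an integer. *)
Lemma dist_int_doubling k t : 0 <= t <= 1 ->
  dist_int (2 ^+ k * t) = tent (iter k doubling t).
Proof.
move=> t01.
have [z ->] : exists z : int, 2 ^+ k * t = iter k doubling t + z%:~R.
  elim: k => [|k [z IH]]; first by exists 0; rewrite mul1r addr0.
  rewrite exprS -mulrA IH iterS; move: (iter k _ _) => v.
  rewrite /doubling; case: ifP => _.
    by exists (2 * z); rewrite intrM; ring.
  by exists (2 * z + 1); rewrite intrD intrM; ring.
by rewrite dist_int_addz dist_int_in01// iter_doubling_in01.
Qed.

(** Unrolls K times a functional inequality along the doubling map. It is used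
    both for the convexity error of a function and for t (1 - t). *)
Lemma doubling_sum_ge (e s : R -> R) t K :
  (forall t, 0 <= t <= 1 -> e t <= s t + e (doubling t) / 2) -> 0 <= t <= 1 ->
  e t <= \sum_(0 <= k < K) (2 ^+ k)^-1 * s (iter k doubling t)
         + (2 ^+ K)^-1 * e (iter K doubling t).
Proof.
move=> es t01; elim: K => [|K IH]; first by rewrite big_nil add0r invr1 mul1r.
apply: le_trans IH _; rewrite big_nat_recr//= -addrA lerD2l.
rewrite exprS invfM [2^-1 * _]mulrC -[_ / 2 * _]mulrA [2^-1 * _]mulrC -mulrDr.
by rewrite ler_wpM2l ?invr_ge0 ?exprn_ge0// es// iter_doubling_in01.
Qed.

(** Iterating this along the orbit of t under the doubling map T, t (1 - t) is
    the sum of the tent (T^k t)^2 / 2^k. *)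
Lemma tent_sqr_doubling t :
  t * (1 - t) = tent t ^+ 2 + doubling t * (1 - doubling t) / 2.
Proof.
rewrite /tent /doubling; case: (leP t (1 - t)) => h1; case: (lerP t (1 / 2)) => h2;
  by [lra | field].
Qed.

(** A finite subset of [0, 1] stable under [doubling] and [tent]; it contains the
    orbit of a rational parameter with denominator N. *)
Definition grid N t := exists2 a : nat, (a <= N)%N & t = a%:R / N%:R.

Lemma grid_in01 N t : (0 < N)%N -> grid N t -> 0 <= t <= 1.
Proof.
move=> N0 [a aN ->]; have N0R : 0 < N%:R :> R by rewrite ltr0n.
by rewrite divr_ge0//= ler_pdivrMr// mul1r ler_nat.
Qed.

Lemma grid_compl N t : (0 < N)%N -> grid N t -> grid N (1 - t).
Proof.
move=> N0 [a aN ->]; exists (N - a)%N; first exact: leq_subr.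
rewrite natrB//; field; by rewrite pnatr_eq0 -lt0n.
Qed.

Lemma grid_tent N t : (0 < N)%N -> grid N t -> grid N (tent t).
Proof. by move=> N0 gt; rewrite /tent; case: leP => // _; exact: grid_compl. Qed.

Lemma grid_doubling N t : (0 < N)%N -> grid N t -> grid N (doubling t).
Proof.
move=> N0 [a aN ->]; have N0R : 0 < N%:R :> R by rewrite ltr0n.
rewrite /doubling; case: ifPn; rewrite -?ltNge.
  rewrite ler_pdivrMr// => h; exists (2 * a)%N; last by rewrite natrM mulrA.
  by rewrite -(ler_nat R) natrM; lra.
rewrite ltr_pdivlMr// => h.
have Na : (N <= 2 * a)%N by rewrite -(ler_nat R) natrM; lra.
exists (2 * a - N)%N; first by rewrite leq_subLR mul2n -addnn leq_add.
by rewrite natrB// natrM; field; rewrite gt_eqF.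
Qed.

Lemma grid_iter_doubling N k t : (0 < N)%N -> grid N t ->
  grid N (iter k doubling t).
Proof. by move=> N0 gt; elim: k => //= k IH; exact: grid_doubling. Qed.

Lemma rational_grid t : 0 <= t <= 1 -> rational t ->
  exists2 N, (0 < N)%N & grid N t.
Proof.
move=> t01 /rationalP[a [b tE]].
case: b tE => [|b] tE.
  (* A fraction a / 0 denotes 0 *)
  by exists 1%N => //; exists 0%N => //; rewrite tE invr0 mulr0 mul0r.
have b0 : 0 < b.+1%:R :> R by rewrite ltr0n.
have : 0 <= a.
  by move/andP: t01 => [+ _]; rewrite tE pmulr_lge0 ?invr_gt0// ler0z.
case: a tE => // a tE _; exists b.+1 => //; exists a => //.
by move/andP: t01 => [_]; rewrite tE ler_pdivrMr// mul1r -pmulrn ler_nat.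
Qed.

Lemma grid_bounded N (F : R -> R) : exists C,
  forall t, grid N t -> `|F t| <= C.
Proof.
exists (\sum_(a < N.+1) `|F (a%:R / N%:R)|).
move=> _ [a aN ->]; have aN' : (a < N.+1)%N by [].
rewrite (bigD1 (Ordinal aN'))//= lerDl; exact: sumr_ge0.
Qed.

End Doubling.

(** * Limits up to a dyadic remainder *)

Section DyadicSeries.
Variable R : realType.

Lemma cvg_half_pow (C : R) : (2 ^+ n)^-1 * C @[n --> \oo] --> 0.
Proof.
have := @cvg_geometric R C 2^-1; rewrite ger0_norm// => /(_ _)H.
under eq_fun do rewrite -exprVn mulrC.
by apply: H; lra.
Qed.

Lemma dyadic_abs_cvg (c : nat -> R) (C : R) : (forall k, `|c k| <= C) ->
  cvgn [normed series (fun k => (2 ^+ k)^-1 * c k)].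
Proof.
move=> cC; have C0 : 0 <= C by apply: le_trans (cC 0%N).
apply: (@series_le_cvg R _ (geometric C 2^-1)) => [n|n|n|].
- exact: normr_ge0.
- by rewrite /= mulr_ge0// exprn_ge0.
- rewrite /= normrM ger0_norm ?invr_ge0 ?exprn_ge0// -exprVn mulrC.
  by rewrite ler_wpM2r// exprn_ge0.
- by apply: is_cvg_geometric_series; rewrite ger0_norm; lra.
Qed.

Lemma lim_ge_dyadic (a C : R) (S b : nat -> R) :
  cvgn S -> (forall k, `|b k| <= C) ->
  (forall K, a <= S K + (2 ^+ K)^-1 * b K) -> a <= limn S.
Proof.
move=> cS bC H; rewrite -[leRHS]addr0.
have cS' : S n + (2 ^+ n)^-1 * C @[n --> \oo] --> limn S + 0.
  exact: cvgD cS (@cvg_half_pow C).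
rewrite -(cvg_lim _ cS')//; apply: limr_ge; first by apply/cvg_ex; eexists; exact: cS'.
near=> K; apply: le_trans (H K) _; rewrite lerD2l.
by rewrite ler_wpM2l ?invr_ge0 ?exprn_ge0// (le_trans (ler_norm _)).
Unshelve. all: by end_near. Qed.

Lemma lim_le_dyadic (a C : R) (S b : nat -> R) :
  cvgn S -> (forall k, `|b k| <= C) ->
  (forall K, S K + (2 ^+ K)^-1 * b K <= a) -> limn S <= a.
Proof.
move=> cS bC H; rewrite -[leRHS]opprK lerNr -limN//.
apply: (@lim_ge_dyadic _ C _ (\- b)) => [|k|K]; first exact: is_cvgN.
  by rewrite normrN.
by rewrite /= mulrN -opprD lerN2.
Qed.

Lemma EFin_lim_series (c : nat -> R) : cvgn (series c) ->
  (\sum_(0 <= k <oo) (c k)%:E = (limn (series c))%:E)%E.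
Proof.
move=> cs; rewrite -EFin_lim//; congr (limn _); apply/funext => n.
by rewrite /= sumEFin.
Qed.

End DyadicSeries.

(** * The Takagi-type series at a rational parameter *)

Section TakagiSeries.
Variables (R : realType) (X : lmodType R) (D : set X).
Hypothesis D_convex : convex_set D.
Variables (phi f0 : X -> R).
Hypothesis f0J : jensen_convex D phi f0.
Hypothesis phi0 : phi 0 = 0.
Variable u : X.
Hypothesis Du : diff_set D u.

Let takagi_coef (lambda : R) k := star_ray phi u (tent (iter k (@doubling R) lambda)).

Lemma takagi_termE (lambda : R) k : 0 <= lambda <= 1 ->
  takagi_term phi lambda u k = ((2 ^+ k)^-1 * takagi_coef lambda k)%:E.
Proof.
move=> l01; rewrite /takagi_term dist_int_doubling// EFinM.
by rewrite (star_rayE D_convex f0J Du)// tent_in// iter_doubling_in01.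
Qed.

Variables (N : nat) (lambda : R).
Hypotheses (N0 : (0 < N)%N) (gl : grid N lambda).

Lemma takagi_abs_cvg :
  cvgn [normed series (fun k => (2 ^+ k)^-1 * takagi_coef lambda k)].
Proof.
have [C HC] := grid_bounded N (star_ray phi u).
apply: (@dyadic_abs_cvg _ _ C) => k; apply: HC; apply: grid_tent => //.
exact: grid_iter_doubling.
Qed.

Lemma takagi_sumE : (\sum_(0 <= k <oo) takagi_term phi lambda u k =
  (limn (series (fun k => (2 ^+ k)^-1 * takagi_coef lambda k)))%:E)%E.
Proof.
rewrite -EFin_lim_series; last exact: normed_cvg takagi_abs_cvg.
by apply: eq_eseriesr => k _; rewrite takagi_termE// (grid_in01 N0).
Qed.

Lemma takagi_abs_sum_fin :
  (\sum_(0 <= k <oo) `|takagi_term phi lambda u k| < +oo)%E.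
Proof.
rewrite (_ : (\sum_(0 <= k <oo) _ = \sum_(0 <= k <oo)
    `|(2 ^+ k)^-1 * takagi_coef lambda k|%:E)%E).
  by rewrite EFin_lim_series ?ltry//; exact: takagi_abs_cvg.
by apply: eq_eseriesr => k _; rewrite takagi_termE// (grid_in01 N0).
Qed.

(** The remainder is controlled for each f separately: along the orbit of lambda,
    the convexity error of f takes only the finitely many values on the grid. *)
Lemma convexity_error_takagi :
  (convexity_error D phi lambda u <= \sum_(0 <= k <oo) takagi_term phi lambda u k)%E.
Proof.
apply: ge_ereal_sup => _ [f [x [y [fJ Dx Dy xyu ->]]]].
rewrite takagi_sumE lee_fin.
pose e t := f (segment x y t) - t * f x - (1 - t) * f y.
rewrite -/(segment x y lambda) -/(e lambda).
have eT t : 0 <= t <= 1 -> e t <= star_ray phi u (tent t) + e (doubling t) / 2.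
  move=> t01; have h := tent_in t01.
  rewrite -lee_fin [leRHS]EFinD (star_rayE D_convex f0J Du)// -leeBlDr// -EFinB.
  have b0 : 0 <= (0 : R) <= 1 by lra.
  have b1 : 0 <= (1 : R) <= 1 by lra.
  (* t is the midpoint of 2t and 0 if t <= 1/2, of 1 and 2t - 1 otherwise. *)
  move: (doubling_in01 t01) h; rewrite /tent /doubling.
  case: (lerP t (1 / 2)) => h2 dt01.
    rewrite min_l; last lra.
    move=> _.
    have := jensen_segment_star D_convex fJ Dx Dy xyu dt01 b0.
    have -> : (2 * t + 0) / 2 = t by field.
    have -> : (2 * t - 0) / 2 = t by field.
    apply: le_trans; rewrite lee_fin /e.
    by rewrite segment0; lra.
  rewrite min_r; last lra.
  move=> _.
  have := jensen_segment_star D_convex fJ Dx Dy xyu b1 dt01.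
  have -> : (1 + (2 * t - 1)) / 2 = t by field.
  have -> : (1 - (2 * t - 1)) / 2 = 1 - t by field.
  apply: le_trans; rewrite lee_fin /e.
  by rewrite segment1; lra.
have [C HC] := grid_bounded N e.
apply: (@lim_ge_dyadic _ _ C _ (fun k => e (iter k (@doubling R) lambda))).
- exact: normed_cvg takagi_abs_cvg.
- by move=> k; apply: HC; exact: grid_iter_doubling.
- by move=> K; apply: (doubling_sum_ge (s := star_ray phi u \o @tent R)) => //;
     exact: (grid_in01 N0).
Qed.

(** Each coefficient is at most (N tent (T^k t))^2 phi^* (u / N), T denoting the
    doubling map, and these bounds sum up to the right-hand side. *)
Lemma takagi_sum_le : (1 < N)%N ->
  (\sum_(0 <= k <oo) takagi_term phi lambda u k
   <= (N%:R ^+ 2 * (lambda * (1 - lambda)))%:E * phi_star phi (N%:R^-1 *: u))%E.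
Proof.
move=> N1; have N1R : 2 <= N%:R :> R by rewrite ler_nat.
have vh : 0 <= (N%:R^-1 : R) <= 1 / 2 by rewrite invr_ge0 ler0n/= div1r lef_pV2 ?posrE; lra.
rewrite takagi_sumE -(star_rayE D_convex f0J Du)// -EFinM lee_fin.
set s := star_ray _ _ _.
pose e t := N%:R ^+ 2 * s * (t * (1 - t)).
have l01 := grid_in01 N0 gl.
have [C HC] := grid_bounded N e.
apply: (@lim_le_dyadic _ _ C _ (fun k => e (iter k (@doubling R) lambda))).
- exact: normed_cvg takagi_abs_cvg.
- by move=> k; apply: HC; exact: grid_iter_doubling.
move=> K.
(* The partial sums have to be bounded from above, so the (exact) recursion for e
   is unrolled with the opposite sign. *)
have := @doubling_sum_ge _ (\- e) (fun t => - (N%:R ^+ 2 * s * tent t ^+ 2)) lambda K.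
move=> /(_ _ l01) H.
rewrite -lerN2 [leLHS](_ : _ = - e lambda); last by rewrite /e; ring.
apply: le_trans (H _) _ => [t t01|].
  by rewrite /= /e tent_sqr_doubling; lra.
rewrite /= opprD mulrN lerD2r /series/= -sumrN ler_sum// => k _.
rewrite mulrN lerN2 ler_wpM2l ?invr_ge0 ?exprn_ge0//.
have gt := grid_iter_doubling k N0 gl.
rewrite /takagi_coef; have := tent_in (grid_in01 N0 gt).
have [a aN ->] := grid_tent N0 gt => /andP[_ ah].
apply: le_trans (star_ray_natmul D_convex f0J phi0 Du _ ah) _; first lra.
rewrite -/s [leRHS](_ : _ = a%:R ^+ 2 * s)//; field.
by rewrite pnatr_eq0 -lt0n.
Qed.

End TakagiSeries.

Theorem theorem3p6 (R : realType) (X : lmodType R) (D : set X)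
    (D_neq0 : D !=set0) (D_convex : convex_set D)
    (phi : X -> R) (phi_adm : admissible D phi) :
  (forall (lambda : R) (u : X),
      0 <= lambda <= 1 -> rational lambda -> diff_set D u ->
      (convexity_error D phi lambda u
         <= \sum_(0 <= k <oo) takagi_term phi lambda u k)%E
      /\ (\sum_(0 <= k <oo) `|takagi_term phi lambda u k| < +oo)%E)
  /\
  (forall (n m : nat) (lambda : R) (u : X),
      (0 < n)%N -> (0 < m)%N -> lambda = n%:R / (n + m)%:R -> diff_set D u ->
      (\sum_(0 <= k <oo) takagi_term phi lambda u k
         <= (n * m)%:R%:E * phi_star phi ((n + m)%:R^-1 *: u))%E).
Proof.
have [_ phi0 [f0 f0J]] := phi_adm.
split=> [lambda u l01 lQ Du|n m lambda u n0 m0 lE Du].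
  have [N N0 gl] : exists2 N, (0 < N)%N & grid N lambda.
    by apply: rational_grid.
  split; first exact: (convexity_error_takagi D_convex f0J Du N0 gl).
  exact: (takagi_abs_sum_fin D_convex f0J Du N0 gl).
have N1 : (1 < n + m)%N by case: n n0 {lE} => // n _; rewrite addSn ltnS addn_gt0 m0 orbT.
have gl : grid (n + m) lambda by exists n => //; exact: leq_addr.
have -> : (n * m)%:R = (n + m)%:R ^+ 2 * (lambda * (1 - lambda)) :> R.
  have nm0 : n%:R + m%:R != 0 :> R by rewrite -natrD pnatr_eq0 -lt0n ltnW.
  by rewrite lE natrM natrD; field.
exact: (takagi_sum_le D_convex f0J phi0 Du (ltnW N1) gl N1).
Qed.
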